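(* Consider the multigrid setting described in the context, with $L+1$ levels and cycle index $\gamma\ge1$ (an integer). Let $$\sigma_{L}:=\max_{1\leq k\leq L}\sigma_{\rm TG}^{(k)},\qquad \varepsilon_{L}:=\min_{1\leq k\leq L}\lambda_{\min}(\widetilde{M}_{k}^{-1}A_{k}),\qquad \delta_{L}:=\min_{1\leq k\leq L}\sigma_{\rm TG}^{(k)},$$ and assume $0<\sigma_{L}<1-\varepsilon_{L}$. Let $x_{\gamma}$ be the (unique) root of $$(1-\sigma_{L}-\varepsilon_{L})x^{\gamma}-x+\sigma_{L}=0\qquad(0<x<1)$$ contained in $\left(\sigma_{L},\frac{\sigma_{L}}{\sigma_{L}+\varepsilon_{L}}\right]$. If $\sigma_{\rm IMG}^{(1)}<x_{\gamma}$, then for all $k=1,\ldots,L$, $$\sigma_{\rm IMG}^{(k)}\leq x_{\gamma}-\big(x_{\gamma}-\sigma_{\rm IMG}^{(1)}\big)\left((1-\sigma_{L}-\varepsilon_{L})\,x_{\gamma}^{\gamma-1}\sum_{j=0}^{\gamma-1}\left(\frac{\delta_{L}}{x_{\gamma}}\right)^{j}\right)^{k-1}.$$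
   Context: SPD means symmetric positive definite. All matrices are real; $I$ is the identity of appropriate size; $M^{-T}=(M^{-1})^T$; $\lambda_{\min}(\cdot)$ is the smallest eigenvalue. For an SPD matrix $A$, $\|\mathbf{v}\|_A=\langle A\mathbf{v},\mathbf{v}\rangle^{1/2}$ and $\|B\|_A=\max_{\mathbf{v}\ne0}\|B\mathbf{v}\|_A/\|\mathbf{v}\|_A$. The convention $0^0=1$ is used in the sum. Multigrid setting: levels are indexed $0,\ldots,L$ ($L\ge1$; $0$ coarsest, $L$ finest), with $n_{L}>n_{L-1}>\cdots>n_{0}$ unknowns. $A_{L}=A\in\mathbb{R}^{n_L\times n_L}$ is SPD. For $k=1,\ldots,L$, $P_{k}\in\mathbb{R}^{n_{k}\times n_{k-1}}$ has rank $n_{k-1}$, and $A_{k-1}:=P_{k}^{T}A_{k}P_{k}$. $\hat{A}_{0}\in\mathbb{R}^{n_0\times n_0}$ is SPD with $\hat{A}_{0}-A_{0}$ symmetric positive semidefinite. For $k=1,\ldots,L$, $M_{k}\in\mathbb{R}^{n_{k}\times n_{k}}$ is nonsingular with $M_{k}+M_{k}^{T}-A_{k}$ SPD, and $$\widetilde{M}_{k}:=M_{k}^{T}(M_{k}+M_{k}^{T}-A_{k})^{-1}M_{k}.$$ The cycle index $\gamma$ is a positive integer ($\gamma=1$: V-cycle, $\gamma=2$: W-cycle). The exact two-grid iteration matrix at level $k$ is $$E_{\rm TG}^{(k)}=(I-M_{k}^{-T}A_{k})(I-P_{k}A_{k-1}^{-1}P_{k}^{T}A_{k})(I-M_{k}^{-1}A_{k}),\qquad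 k=1,\ldots,L.$$ The (inexact) multigrid iteration matrices (one presmoothing step with $M_k$, one postsmoothing step with $M_k^T$, $\gamma$ recursive iterations with zero initial guess for the coarse correction, and $\hat A_0^{-1}$ used on the coarsest level) are $$E_{\rm IMG}^{(1)}=(I-M_{1}^{-T}A_{1})(I-P_{1}\hat{A}_{0}^{-1}P_{1}^{T}A_{1})(I-M_{1}^{-1}A_{1}),$$ $$E_{\rm IMG}^{(k)}=(I-M_{k}^{-T}A_{k})\Big[I-P_{k}\Big(I-\big(E_{\rm IMG}^{(k-1)}\big)^{\gamma}\Big)A_{k-1}^{-1}P_{k}^{T}A_{k}\Big](I-M_{k}^{-1}A_{k}),\qquad k=2,\ldots,L.$$ The convergence factors are $\sigma_{\rm TG}^{(k)}:=\|E_{\rm TG}^{(k)}\|_{A_{k}}$ and $\sigma_{\rm IMG}^{(k)}:=\|E_{\rm IMG}^{(k)}\|_{A_{k}}$. *)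

(* Defs.v *)
From mathcomp Require Import all_boot all_order all_algebra.
From mathcomp Require Import all_classical all_reals.

Set Implicit Arguments.
Unset Strict Implicit.
Unset Printing Implicit Defensive.

Import Order.TTheory GRing.Theory Num.Theory.
Local Open Scope classical_set_scope.
Local Open Scope ring_scope.

Section LinearAlgebra.
Variable R : realType.

Definition qform m (A : 'M[R]_m) (v : 'cV[R]_m) : R := (v^T *m A *m v) 0 0.

Definition spd m (A : 'M[R]_m) : Prop :=
  A^T = A /\ forall v : 'cV[R]_m, v != 0 -> 0 < qform A v.

Definition spsd m (A : 'M[R]_m) : Prop :=
  A^T = A /\ forall v : 'cV[R]_m, 0 <= qform A v.

Definition vnorm m (A : 'M[R]_m) (v : 'cV[R]_m) : R := Num.sqrt (qform A v).

(* For [0 < m] and [A] SPD the supremum is attained, so it is the maximum. *)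
Definition mxnorm m (A B : 'M[R]_m) : R :=
  sup [set vnorm A (B *m v) / vnorm A v | v in [set v : 'cV[R]_m | v != 0]].

(* Least real eigenvalue: a matrix has finitely many eigenvalues, so the
   infimum is a minimum as soon as there is one.  Row eigenvectors, used by
   [eigenvalue], give the same spectrum as column eigenvectors. *)
Definition lambda_min m (B : 'M[R]_m) : R := inf [set a : R | eigenvalue B a].

(* Extrema of [f 1], ..., [f L]; they are meant for [0 < L]. *)
Definition level_max (L : nat) (f : nat -> R) : R :=
  \big[Num.max/f 1%N]_(1%N <= k < L.+1) f k.

Definition level_min (L : nat) (f : nat -> R) : R :=
  \big[Num.min/f 1%N]_(1%N <= k < L.+1) f k.

End LinearAlgebra.

(* Families are indexed by all of [nat]; only the levels [0 <= k <= L] (for [A])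
   and [1 <= k <= L] (for [P] and [M]) are meaningful.  [P k] maps level [k.-1]
   to level [k], and [P 0], [M 0] are never used. *)
Section Multigrid.
Variables (R : realType) (n : nat -> nat).
Variable A : forall k, 'M[R]_(n k).
Variable P : forall k, 'M[R]_(n k, n k.-1).
Variable M : forall k, 'M[R]_(n k).
Variable Ahat0 : 'M[R]_(n 0%N).
Variable gamma : nat.

Definition Mtilde k : 'M[R]_(n k) :=
  (M k)^T *m invmx (M k + (M k)^T - A k) *m M k.

(* One presmoothing step, a coarse correction using [B] in place of
   [invmx (A k.-1)], and one postsmoothing step. *)
Definition cycle_mx k (B : 'M[R]_(n k.-1)) : 'M[R]_(n k) :=
  (1%:M - (invmx (M k))^T *m A k)
  *m (1%:M - P k *m B *m (P k)^T *m A k)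
  *m (1%:M - invmx (M k) *m A k).

Definition E_TG k : 'M[R]_(n k) := cycle_mx (invmx (A k.-1)).

(* The coarse solver at level [k], given the multigrid iteration matrix [E]
   there; [E] is ignored on the coarsest level. *)
Definition coarse_solver k : 'M[R]_(n k) -> 'M[R]_(n k) :=
  match k return 'M[R]_(n k) -> 'M[R]_(n k) with
  | 0%N => fun=> invmx Ahat0
  | j.+1 => fun E => (1%:M - E ^+ gamma) *m invmx (A j.+1)
  end.

(* There is no iteration matrix at level [0]: the value there is a dummy, which
   [coarse_solver] ignores. *)
Fixpoint E_IMG k : 'M[R]_(n k) :=
  match k return 'M[R]_(n k) with
  | 0%N => 0
  | j.+1 => @cycle_mx j.+1 (coarse_solver (E_IMG j))
  end.

Definition sigma_TG k : R := mxnorm (A k) (E_TG k).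

Definition sigma_IMG k : R := mxnorm (A k) (E_IMG k).

End Multigrid.

(* Main.v *)
Require Import Defs.
From mathcomp Require Import all_boot all_order all_algebra.
From mathcomp Require Import all_classical all_reals.
From mathcomp Require Import ring lra.
Import Order.TTheory GRing.Theory Num.Theory.
Local Open Scope ring_scope.

Set Implicit Arguments.
Unset Strict Implicit.

(** Every iteration matrix [E] of the hierarchy is self-adjoint and positive
    semidefinite for the energy inner product of its level: [A *m E] is symmetric
    positive semidefinite.  For such an [E] the energy norm is the least
    [b >= 0] with [qform (A *m E) v <= b * qform A v] for all [v]
    ([mxnorm_qform], [mxnorm_le]), so convergence factors can be compared by
    comparing quadratic forms.

    Put [N = 1 - M^-1 A], and let [c] be the vector of coarse coordinates of the
    energy projection of [N v] onto the range of [P].  The form of the multigrid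
    matrix at [v] is the form of the exact two-grid matrix at [v], which is the
    squared energy norm of the part of [N v] orthogonal to that range, plus the
    form of [E ^+ gamma] at [c], where [E] is the iteration matrix one level
    below.  The latter lies between [0] and [s ^+ gamma] times the squared energy
    norm of [c], where [s] is the norm of [E]; and that squared norm is the one of
    [N v] minus the two-grid form.  Since the squared energy norm of [N v] is at
    most [1 - eps] times that of [v] ([smoother_bound]), this gives
      [sigma_IMG k.+1 <= (1 - t) * sigma_TG k.+1 + t * (1 - eps)],
    with [t = sigma_IMG k ^+ gamma] ([sigma_IMG_step]), and
    [sigma_TG k <= sigma_IMG k] ([sigma_TG_le_IMG]).

    On level [1] the coarse term comes from [Ahat0] instead; as [Ahat0] dominates
    [A 0], it lies between [0] and the squared energy norm of [c]
    ([coarse_error_dominating]), which starts the induction.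

    What remains concerns real numbers.  The norms [s k = sigma_IMG k] satisfy
    [s k.+1 <= sigma + c * s k ^+ gamma] with [c = 1 - sigma - eps], and [x] is
    the fixed point of the right-hand side below [1]; subtracting and factoring
    [x ^+ gamma - s k ^+ gamma], in which [s k] may be replaced by its lower bound
    [delta], gives the geometric rate ([fixpoint_error_step]).

    The spectral facts needed are obtained without diagonalization: a positive
    definite form dominates a multiple of any other form ([spd_coercive]), and
    hence the infimum of the Rayleigh quotient is an eigenvalue
    ([lambda_min_rayleigh]). *)

(** * Quadratic forms *)

Section QuadraticForms.
Variable R : realType.

Definition bform m (S : 'M[R]_m) (u v : 'cV[R]_m) : R := (u^T *m S *m v) 0 0.

Lemma qformE m (S : 'M[R]_m) v : qform S v = bform S v v.
Proof. by []. Qed.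

Lemma bformDl m (S : 'M[R]_m) u v w :
  bform S (u + v) w = bform S u w + bform S v w.
Proof. by rewrite /bform linearD !mulmxDl mxE. Qed.

Lemma bformDr m (S : 'M[R]_m) u v w :
  bform S w (u + v) = bform S w u + bform S w v.
Proof. by rewrite /bform mulmxDr mxE. Qed.

Lemma bformZl m (S : 'M[R]_m) a u v : bform S (a *: u) v = a * bform S u v.
Proof. by rewrite /bform linearZ -!scalemxAl mxE. Qed.

Lemma bformZr m (S : 'M[R]_m) a u v : bform S u (a *: v) = a * bform S u v.
Proof. by rewrite /bform -scalemxAr mxE. Qed.

Lemma bformNl m (S : 'M[R]_m) u v : bform S (- u) v = - bform S u v.
Proof. by rewrite -scaleN1r bformZl mulN1r. Qed.

Lemma bformNr m (S : 'M[R]_m) u v : bform S u (- v) = - bform S u v.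
Proof. by rewrite -scaleN1r bformZr mulN1r. Qed.

Lemma bform_mulr m p (S : 'M[R]_m) (B : 'M[R]_(m, p)) u v :
  bform S u (B *m v) = (u^T *m (S *m B) *m v) 0 0.
Proof. by rewrite /bform !mulmxA. Qed.

Lemma bform_mull m (S B : 'M[R]_m) u v :
  bform S (B *m u) v = bform (B^T *m S) u v.
Proof. by rewrite /bform trmx_mul !mulmxA. Qed.

Lemma bform_sym m (S : 'M[R]_m) u v : S^T = S -> bform S u v = bform S v u.
Proof.
move=> St; rewrite /bform.
have -> : (u^T *m S *m v) 0 0 = (u^T *m S *m v)^T 0 0 by rewrite [RHS]mxE.
by rewrite !trmx_mul trmxK St mulmxA.
Qed.

Lemma qform_congr m p (S : 'M[R]_m) (B : 'M[R]_(m, p)) v :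
  qform S (B *m v) = qform (B^T *m S *m B) v.
Proof. by rewrite /qform trmx_mul !mulmxA. Qed.

Lemma qformD m (S T : 'M[R]_m) v : qform (S + T) v = qform S v + qform T v.
Proof. by rewrite /qform mulmxDr mulmxDl mxE. Qed.

Lemma qformN m (S : 'M[R]_m) v : qform (- S) v = - qform S v.
Proof. by rewrite /qform mulmxN mulNmx mxE. Qed.

Lemma qformZ m a (S : 'M[R]_m) v : qform (a *: S) v = a * qform S v.
Proof. by rewrite /qform -scalemxAr -scalemxAl mxE. Qed.

Lemma qform0 m (S : 'M[R]_m) : qform S 0 = 0.
Proof. by rewrite /qform mulmx0 mxE. Qed.

Lemma spd_spsd m (S : 'M[R]_m) : spd S -> spsd S.
Proof.
move=> [St Sp]; split=> // v; case: (eqVneq v 0) => [->|/Sp/ltW //].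
by rewrite qform0.
Qed.

(** Stated for semidefinite forms, because it is applied to [A *m E], which is
    singular in general. *)
Lemma cauchy_schwarz m (S : 'M[R]_m) u v :
  spsd S -> bform S u v ^+ 2 <= qform S u * qform S v.
Proof.
move=> [St Sp].
have E a b : 0 <= a ^+ 2 * qform S u + 2 * a * b * bform S u v
    + b ^+ 2 * qform S v.
  have := Sp (a *: u + b *: v).
  rewrite qformE !bformDl !bformDr !bformZl !bformZr (bform_sym v u St).
  rewrite -!qformE.
  by congr (_ <= _); ring.
have u0 := Sp u; have v0 := Sp v.
set b := bform S u v in E *.
move: u0 v0 E; move: (qform S u) (qform S v) b => p q b p0 q0 E.
have [q_eq0|qN0] := eqVneq q 0.
  (* a null vector is in the radical: otherwise a large multiple of it would
     make the form negative *)
  have [->|bN0] := eqVneq b 0; first by rewrite expr0n mulr_ge0.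
  have := E 1 (- (p + 1) / (2 * b)).
  rewrite q_eq0 (_ : _ + _ = -1) ?ler0N1 //.
  by field.
have qp : 0 < q by rewrite lt_def qN0.
(* the usual minimizer of the form along the line, cleared of denominators *)
have := E q (- b).
rewrite (_ : _ + _ = q * (p * q - b ^+ 2)); last by ring.
by rewrite pmulr_rge0 // subr_ge0.
Qed.

Lemma unitmx_inj m (S : 'M[R]_m) :
  (forall v : 'cV_m, S *m v = 0 -> v = 0) -> S \in unitmx.
Proof.
move=> inj; rewrite -unitmx_tr -row_free_unit -kermx_eq0.
apply/eqP/row_matrixP => i; rewrite row0.
apply: trmx_inj; rewrite trmx0; apply: inj.
apply: trmx_inj; rewrite trmx_mul trmxK trmx0.
by apply: (sub_kermxP _); apply: row_sub.
Qed.

Lemma mxrank_inj m p (P : 'M[R]_(m, p)) : \rank P = p ->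
  forall v : 'cV_p, P *m v = 0 -> v = 0.
Proof.
move=> rP v Pv0; apply: trmx_inj; rewrite trmx0; apply/eqP.
have fP : row_free P^T by rewrite /row_free mxrank_tr rP.
by rewrite -(mulmx_free_eq0 _ fP) -trmx_mul Pv0 trmx0.
Qed.

Lemma spd_unit m (S : 'M[R]_m) : spd S -> S \in unitmx.
Proof.
move=> [_ Sp]; apply: unitmx_inj => v Sv0; apply/eqP/negPn/negP => /Sp.
by rewrite /qform -mulmxA Sv0 mulmx0 mxE ltxx.
Qed.

(** By Cauchy--Schwarz a null vector of the form is orthogonal to all basis
    vectors, hence lies in the kernel. *)
Lemma spsd_unit_spd m (S : 'M[R]_m) : spsd S -> S \in unitmx -> spd S.
Proof.
move=> S0 Su; have [St Sp] := S0; split=> // v v0.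
rewrite lt_def Sp andbT; apply: contra_neq v0 => qv0.
suff Sv0 : S *m v = 0 by rewrite -(mulKmx Su v) Sv0 mulmx0.
apply/colP => i; rewrite [RHS]mxE.
have := cauchy_schwarz (delta_mx i 0) v S0.
rewrite qv0 mulr0 => b_le0.
have : bform S (delta_mx i 0) v ^+ 2 == 0 by rewrite eq_le b_le0 sqr_ge0.
by rewrite sqrf_eq0 /bform -mulmxA trmx_delta -rowE mxE => /eqP.
Qed.

Lemma spd_inv m (S : 'M[R]_m) : spd S -> spd (invmx S).
Proof.
move=> S0; have Su := spd_unit S0; have [St Sp] := S0.
split=> [|v v0]; first by rewrite trmx_inv St.
have : 0 < qform S (invmx S *m v).
  apply: Sp; apply: contra_neq v0 => e; rewrite -(mulKVmx Su v) e mulmx0 //.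
by rewrite qform_congr trmx_inv St mulVmx // mul1mx.
Qed.

Lemma spd_congr m p (S : 'M[R]_m) (B : 'M[R]_(m, p)) :
  spd S -> (forall v : 'cV_p, B *m v = 0 -> v = 0) -> spd (B^T *m S *m B).
Proof.
move=> [St Sp] inj; split=> [|v v0].
  by rewrite !trmx_mul trmxK St mulmxA.
by rewrite -qform_congr Sp //; apply: contra_neq v0 => /inj.
Qed.

Lemma spsd_congr m p (S : 'M[R]_m) (B : 'M[R]_(m, p)) :
  spsd S -> spsd (B^T *m S *m B).
Proof.
move=> [St Sp]; split=> [|v]; first by rewrite !trmx_mul trmxK St mulmxA.
by rewrite -qform_congr.
Qed.

Lemma qform_le_sqr m (S : 'M[R]_m) :
  exists2 C, 0 < C & forall v, qform S v <= C * qform 1%:M v.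
Proof.
pose C := \sum_j \sum_i `|S i j|.
have C0 : 0 <= C by apply: sumr_ge0 => j _; apply: sumr_ge0.
exists (C + 1) => [|v]; first by lra.
have nE : qform 1%:M v = \sum_i v i 0 ^+ 2.
  rewrite /qform mulmx1 mxE; apply: eq_bigr => i _.
  by rewrite mxE expr2.
have n0 : 0 <= qform 1%:M v.
  by rewrite nE; apply: sumr_ge0 => i _; apply: sqr_ge0.
have vi i : v i 0 ^+ 2 <= qform 1%:M v.
  rewrite nE (bigD1 i) //= lerDl.
  by apply: sumr_ge0 => j _; apply: sqr_ge0.
suff : qform S v <= C * qform 1%:M v by lra.
rewrite {1}/qform mxE mulr_suml; apply: ler_sum => j _.
rewrite mxE !mulr_suml; apply: ler_sum => i _.
rewrite mxE mulrAC mulrC.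
apply: le_trans (ler_norm _) _; rewrite normrM ler_wpM2l //.
have := vi i; have := vi j.
move: (v i 0) (v j 0) (qform 1%:M v) => a b N.
by rewrite ler_norml => ? ?; apply/andP; split; nra.
Qed.

(** Cauchy--Schwarz for [S], applied to [v] and [invmx S *m v], turns an upper
    bound on the inverse into a lower bound on [S]; this plays the part of the
    compactness of the unit sphere. *)
Lemma spd_coercive m (S A : 'M[R]_m) :
  spd S -> exists2 c, 0 < c & forall v, c * qform A v <= qform S v.
Proof.
move=> S0; have Su := spd_unit S0; have [St Sp] := S0.
have [C1 C1p H1] := qform_le_sqr A.
have [C2 C2p H2] := qform_le_sqr (invmx S).
exists (C1 * C2)^-1 => [|v]; first by rewrite invr_gt0 mulr_gt0.
rewrite mulrC ler_pdivrMr ?mulr_gt0 //.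
have := cauchy_schwarz (invmx S *m v) v (spd_spsd S0).
rewrite bform_mull qform_congr trmx_inv St mulVmx // mul1mx -qformE.
have n0 : 0 <= qform 1%:M v.
  rewrite /qform mulmx1 mxE; apply: sumr_ge0 => i _.
  by rewrite mxE -expr2 sqr_ge0.
have q0 := (spd_spsd S0).2 v.
move: (H1 v) (H2 v) n0 q0.
move: (qform A v) (qform (invmx S) v) (qform 1%:M v) (qform S v) => a b N q ? ? N0 q0 h.
have : N <= C2 * q.
  have [->|NN0] := eqVneq N 0; first by rewrite mulr_ge0 // ltW.
  have Np : 0 < N by rewrite lt_def NN0.
  rewrite -(ler_pM2l Np); apply: le_trans (_ : b * q <= _); first by rewrite -expr2.
  by rewrite mulrA (mulrC N) ler_wpM2r.
nra.
Qed.

End QuadraticForms.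

(** * Least eigenvalue and smoothers *)

Section Spectrum.
Variable R : realType.

Lemma eigenvalue_unit m (T : 'M[R]_m) a :
  eigenvalue T a = (T - a%:M \notin unitmx).
Proof. by rewrite /eigenvalue /eigenspace kermx_eq0 row_free_unit. Qed.

Lemma eigenvalue_colP m (T : 'M[R]_m) a :
  eigenvalue T a -> exists2 v : 'cV_m, v != 0 & T *m v = a *: v.
Proof.
rewrite eigenvalue_unit -unitmx_tr -row_free_unit -kermx_eq0.
move=> /rowV0Pn [v /sub_kermxP vT v0]; exists v^T.
  by apply: contra_neq v0 => e; rewrite -(trmxK v) e trmx0.
apply/eqP; rewrite -subr_eq0 -mul_scalar_mx -mulmxBl; apply/eqP.
by apply: trmx_inj; rewrite trmx_mul trmxK vT trmx0.
Qed.

Lemma nonzero_cV m : (0 < m)%N -> exists v : 'cV[R]_m, v != 0.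
Proof.
move=> m0; exists (const_mx 1); apply/negP => /eqP /matrixP /(_ (Ordinal m0) 0).
by rewrite !mxE => /eqP; rewrite oner_eq0.
Qed.

(** The infimum [r] of the Rayleigh quotient is an eigenvalue, and every other
    eigenvalue is a Rayleigh quotient, so [lambda_min T] is [r]. *)
Lemma lambda_min_rayleigh m (A T : 'M[R]_m) :
  (0 < m)%N -> spd A -> spd (A *m T) ->
  0 < lambda_min T /\
  forall v, lambda_min T * qform A v <= qform (A *m T) v.
Proof.
move=> m0 A0 S0; have [At Ap] := A0; have [St Sp] := S0.
pose Q := [set qform (A *m T) v / qform A v | v in [set v : 'cV[R]_m | v != 0]]%classic.
have Qne : (Q !=set0)%classic.
  by have [v v0] := nonzero_cV m0; exists (qform (A *m T) v / qform A v), v.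
have Qlb : lbound Q 0.
  by move=> _ [v v0 <-]; rewrite divr_ge0 // ltW ?Ap ?Sp.
set r := inf Q.
have r_le v : r * qform A v <= qform (A *m T) v.
  have [->|v0] := eqVneq v 0; first by rewrite !qform0 mulr0.
  rewrite -ler_pdivlMr ?Ap //; apply: ge_inf; first by exists 0.
  by exists v.
have eigen_in a : eigenvalue T a -> Q a.
  move=> /eigenvalue_colP [v v0 e]; exists v => //.
  rewrite /qform mulmxA -mulmxA e -scalemxAr mxE mulfK //.
  by rewrite gt_eqF // Ap.
have r_eigen : eigenvalue T r.
  (* otherwise [A *m T - r *: A] would be positive definite, and coercivity
     would leave room below the infimum *)
  rewrite eigenvalue_unit; apply/negP => u.
  have XE : A *m T - r *: A = A *m (T - r%:M).
    by rewrite mulmxBr mul_mx_scalar.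
  have X0 : spd (A *m T - r *: A).
    apply: spsd_unit_spd; last by rewrite XE unitmx_mul (spd_unit A0).
    split=> [|v]; first by rewrite linearB linearZ /= St At.
    by rewrite qformD qformN qformZ subr_ge0.
  have [c c0 cX] := spd_coercive A X0.
  suff : r + c <= r by lra.
  apply: lb_le_inf => // _ [v v0 <-].
  rewrite ler_pdivlMr ?Ap //; have := cX v.
  by rewrite qformD qformN qformZ mulrDl; lra.
have -> : lambda_min T = r.
  apply/eqP; rewrite eq_le; apply/andP; split.
    apply: ge_inf => //; exists 0 => a /eigen_in; exact: Qlb.
  by apply: lb_le_inf; [exists r | move=> a /eigen_in; apply: ge_inf; exists 0].
split=> //; have [v v0 e] := eigenvalue_colP r_eigen.
have := Sp v v0; rewrite /qform mulmxA -mulmxA e -scalemxAr mxE.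
by rewrite pmulr_lgt0 // Ap.
Qed.

Section Smoother.
Variables (m : nat) (A M : 'M[R]_m).
Hypotheses (m_gt0 : (0 < m)%N) (A_spd : spd A) (M_unit : M \in unitmx).
Hypothesis S_spd : spd (M + M^T - A).

Let N := 1%:M - invmx M *m A.
Let N' := 1%:M - (invmx M)^T *m A.
Let eps := lambda_min (invmx (M^T *m invmx (M + M^T - A) *m M) *m A).

Lemma smoother_adjoint : A *m N' = N^T *m A.
Proof.
rewrite /N /N' mulmxBr mulmx1 linearB /= trmx1 trmx_mul A_spd.1 mulmxBl mul1mx.
by rewrite !mulmxA.
Qed.

Let T := invmx (M^T *m invmx (M + M^T - A) *m M) *m A.

Lemma inv_MtildeE :
  invmx (M^T *m invmx (M + M^T - A) *m M) =
  invmx M *m (M + M^T - A) *m (invmx M)^T.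
Proof.
have Su := spd_unit S_spd.
have MTu : M^T \in unitmx by rewrite unitmx_tr.
have u : M^T *m invmx (M + M^T - A) *m M \in unitmx.
  by rewrite !unitmx_mul unitmx_inv MTu Su M_unit.
apply: (can_inj (mulKmx u)); rewrite mulmxV //.
by rewrite !mulmxA mulmxK // mulmxKV // trmx_inv mulmxV.
Qed.

Lemma mulmx_inv_MtildeE :
  A *m T = ((invmx M)^T *m A)^T *m (M + M^T - A) *m ((invmx M)^T *m A).
Proof. by rewrite /T inv_MtildeE trmx_mul trmxK A_spd.1 !mulmxA. Qed.

(** The energy lost in one step of the adjoint smoother is the form of [A *m T],
    so Rayleigh quotients of [T] control the norm of [N']. *)
Lemma mulmx_inv_Mtilde_subE : A *m T = A - N'^T *m A *m N'.
Proof.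
have N'T : N'^T = 1%:M - A *m invmx M.
  by rewrite linearB /= trmx1 trmx_mul trmxK A_spd.1.
have UM : A *m invmx M *m M = A by rewrite mulmxKV.
have MU : M^T *m (invmx M)^T = 1%:M by rewrite trmx_inv mulmxV ?unitmx_tr.
rewrite /T inv_MtildeE N'T /N' !mulmxA.
move: UM; set X := A *m invmx M => UM.
set U := (invmx M)^T in MU *.
rewrite ?(mulmxBr, mulmxDr, mulmxBl, mulmxDl) UM -(mulmxA X M^T U) MU.
rewrite !mul1mx !mulmx1 !mulmxN !mulNmx !mulmxA.
by apply/matrixP => i j; rewrite !mxE; ring.
Qed.

Lemma AT_spd : spd (A *m T).
Proof.
rewrite mulmx_inv_MtildeE; apply: spd_congr => // v e.
have u : (invmx M)^T *m A \in unitmx.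
  by rewrite unitmx_mul unitmx_tr unitmx_inv M_unit spd_unit.
by rewrite -(mulKmx u v) e mulmx0.
Qed.

Lemma smoother_eps_gt0 : 0 < eps.
Proof. exact: (lambda_min_rayleigh m_gt0 A_spd AT_spd).1. Qed.

(** Rayleigh quotients bound [N'], the [A]-adjoint of [N], and
    [|N v|^2 = <N' (N v), v> <= |N' (N v)| |v|] carries the bound over to [N]. *)
Lemma smoother_bound v : qform A (N *m v) <= (1 - eps) * qform A v.
Proof.
have bound' w : qform A (N' *m w) <= (1 - eps) * qform A w.
  have := (lambda_min_rayleigh m_gt0 A_spd AT_spd).2 w.
  rewrite -/eps mulmx_inv_Mtilde_subE qformD qformN -qform_congr.
  lra.
have A0 := spd_spsd A_spd.
have := cauchy_schwarz (N' *m (N *m v)) v A0.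
have -> : bform A (N' *m (N *m v)) v = qform A (N *m v).
  rewrite (bform_sym _ _ A_spd.1) qformE bform_mull -smoother_adjoint.
  by rewrite /bform !mulmxA.
have := bound' (N *m v); have := bound' v.
have := A0.2 v; have := A0.2 (N *m v); have := A0.2 (N' *m v).
move: (qform A (N' *m v)) (qform A (N' *m (N *m v))) (qform A (N *m v)).
move: (qform A v) (1 - eps) => q c p' p'' p h1 h2 h3 h4 h5 h6.
have [->|pN0] := eqVneq p 0; first lra.
have pp : 0 < p by rewrite lt_def pN0.
rewrite -(ler_pM2l pp); apply: le_trans (_ : p'' * q <= _).
  by rewrite -expr2.
by rewrite mulrA (mulrC p) ler_wpM2r.
Qed.

End Smoother.
End Spectrum.

(** * Energy norm of self-adjoint positive semidefinite matrices *)

Section Norm.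
Variable R : realType.

(** Cauchy--Schwarz for the form of [A *m E], applied to [E v] and [v], bounds
    [|E v|^4] by [(b |E v|^2) (b |v|^2)]. *)
Lemma qform_mul_le m (A E : 'M[R]_m) b :
  spd A -> spsd (A *m E) -> (forall v, qform (A *m E) v <= b * qform A v) ->
  0 <= b -> forall v, qform A (E *m v) <= b ^+ 2 * qform A v.
Proof.
move=> A0 E0 Eb b0 v.
have := cauchy_schwarz (E *m v) v E0.
have -> : bform (A *m E) (E *m v) v = qform A (E *m v).
  by rewrite qformE /bform !mulmxA.
have := Eb v; have := Eb (E *m v); have := E0.2 v; have := E0.2 (E *m v).
have := (spd_spsd A0).2 v; have := (spd_spsd A0).2 (E *m v).
move: (qform A (E *m v)) (qform A v) (qform (A *m E) (E *m v)) (qform (A *m E) v) => p q x y.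
move=> p0 q0 x0 y0 xb yb h.
have [->|pN0] := eqVneq p 0; first by rewrite mulr_ge0 ?sqr_ge0.
have pp : 0 < p by rewrite lt_def pN0.
rewrite -(ler_pM2l pp) -expr2; apply: le_trans h _.
apply: le_trans (_ : (b * p) * (b * q) <= _); first exact: ler_pM.
by rewrite le_eqVlt; apply/orP; left; apply/eqP; ring.
Qed.

Lemma qform_le_of_mul m (A E : 'M[R]_m) b :
  spd A -> 0 <= b -> (forall v, qform A (E *m v) <= b ^+ 2 * qform A v) ->
  forall v, qform (A *m E) v <= b * qform A v.
Proof.
move=> A0 b0 Eb v.
have := cauchy_schwarz v (E *m v) (spd_spsd A0).
have -> : bform A v (E *m v) = qform (A *m E) v by rewrite /qform /bform !mulmxA.
have := Eb v; have := (spd_spsd A0).2 v.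
move: (qform A (E *m v)) (qform A v) (qform (A *m E) v) => p q x q0 h1 h2.
have h3 : x ^+ 2 <= (b * q) ^+ 2.
  apply: le_trans h2 _; rewrite (_ : _ ^+ 2 = q * (b ^+ 2 * q)); last by ring.
  by rewrite ler_wpM2l.
have bq : 0 <= b * q by rewrite mulr_ge0.
by apply: le_trans (ler_norm x) _; rewrite -ler_sqr ?nnegrE // real_normK ?num_real.
Qed.

(** The bound [E <= 1] in the sense of forms ensures that the set whose supremum
    is [mxnorm] is bounded; [sup] would take a default value otherwise. *)
Section Psd.
Variables (m : nat) (A E : 'M[R]_m).
Hypotheses (m_gt0 : (0 < m)%N) (A_spd : spd A) (E_spsd : spsd (A *m E)).
Hypothesis (E_le : forall v, qform (A *m E) v <= qform A v).

Let Q := [set vnorm A (E *m v) / vnorm A v | v in [set v : 'cV[R]_m | v != 0]]%classic.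

Let Q_le b v : 0 <= b -> v != 0 ->
  (vnorm A (E *m v) / vnorm A v <= b) = (qform A (E *m v) <= b ^+ 2 * qform A v).
Proof.
move=> b0 v0; rewrite ler_pdivrMr ?sqrtr_gt0 ?A_spd.2 //.
rewrite -ler_sqr ?nnegrE ?mulr_ge0 ?sqrtr_ge0 // exprMn.
by rewrite !sqr_sqrtr // (spd_spsd A_spd).2.
Qed.

Let Q_ne : (Q !=set0)%classic.
Proof.
by have [v v0] := nonzero_cV R m_gt0; exists (vnorm A (E *m v) / vnorm A v), v.
Qed.

Let Q_ub : has_ubound Q.
Proof.
exists 1 => _ [v v0 <-]; rewrite Q_le //; apply: qform_mul_le => // w.
by rewrite mul1r.
Qed.

Lemma mxnorm_ge0 : 0 <= mxnorm A E.
Proof.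
have [x [v v0 e]] := Q_ne; apply: le_trans (_ : vnorm A (E *m v) / vnorm A v <= _).
  by rewrite divr_ge0 ?sqrtr_ge0.
by apply: ub_le_sup => //; exists v.
Qed.

Lemma mxnorm_qform v : qform (A *m E) v <= mxnorm A E * qform A v.
Proof.
apply: qform_le_of_mul; rewrite ?mxnorm_ge0 // => w.
have [->|w0] := eqVneq w 0; first by rewrite mulmx0 qform0 mulr0.
by rewrite -Q_le ?mxnorm_ge0 //; apply: ub_le_sup => //; exists w.
Qed.

Lemma mxnorm_le b : 0 <= b -> (forall v, qform (A *m E) v <= b * qform A v) ->
  mxnorm A E <= b.
Proof.
move=> b0 Eb; apply: ge_sup => // _ [v v0 <-].
by rewrite Q_le //; apply: qform_mul_le.
Qed.

End Psd.

(** The induction goes by steps of two: [A E^(g+2)] is the congruence of [A E^g]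
    by [E]. *)
Lemma spsd_mul_exp m (A E : 'M[R]_m) g :
  spd A -> spsd (A *m E) -> spsd (A *m E ^+ g).
Proof.
move=> A0 E0; have AE : A *m E = E^T *m A by rewrite -[LHS]E0.1 trmx_mul A0.1.
elim/ltn_ind: g => -[|[|g]] IH.
- by rewrite expr0 mulmx1; apply: spd_spsd.
- by rewrite expr1.
- rewrite exprS exprSr -!mulmxE !mulmxA AE -(mulmxA _ A).
  by apply: spsd_congr; apply: IH.
Qed.

Lemma qform_exp_le m (A E : 'M[R]_m) s g :
  spd A -> spsd (A *m E) -> 0 <= s ->
  (forall v, qform (A *m E) v <= s * qform A v) ->
  forall v, qform (A *m E ^+ g) v <= s ^+ g * qform A v.
Proof.
move=> A0 E0 s0 Es; apply: qform_le_of_mul; rewrite ?exprn_ge0 //.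
elim: g => [|g IH] v; first by rewrite !expr0 expr1n mul1r mul1mx.
rewrite exprS -mulmxE -mulmxA; apply: le_trans (qform_mul_le A0 E0 Es s0 _) _.
by rewrite [s ^+ g.+1]exprS exprMn -[leRHS]mulrA ler_wpM2l ?sqr_ge0.
Qed.

End Norm.

(** * Approximate coarse solvers *)

Section CoarseSolvers.
Variable R : realType.

(** The relative error of [B] as an approximation from below of the inverse of
    [Ac]; these bounds are all that the analysis of a cycle uses about its coarse
    solver. *)
Definition coarse_error_le p (Ac B : 'M[R]_p) (t : R) : Prop :=
  B^T = B /\ forall y,
    0 <= qform (invmx Ac) y - qform B y <= t * qform (invmx Ac) y.

Lemma coarse_error_exact p (Ac : 'M[R]_p) : spd Ac -> coarse_error_le Ac (invmx Ac) 0.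
Proof.
by move=> Ac0; split=> [|y]; [exact: (spd_inv Ac0).1 | rewrite mul0r subrr lexx].
Qed.

(** Inversion reverses the order of positive definite forms, again by
    Cauchy--Schwarz: with [d = Ac^-1 y] and [e = Ah^-1 y], the number [<y, e>] is
    also [<Ac d, e>], and [<Ac e, e> <= <Ah e, e> = <y, e>]. *)
Lemma coarse_error_dominating p (Ac Ah : 'M[R]_p) :
  spd Ac -> spd Ah -> spsd (Ah - Ac) -> coarse_error_le Ac (invmx Ah) 1.
Proof.
move=> Ac0 Ah0 D0; have [Aht _] := Ah0; have [Act _] := Ac0.
have Ahu := spd_unit Ah0; have Acu := spd_unit Ac0.
split=> [|y]; first exact: (spd_inv Ah0).1.
have := cauchy_schwarz (invmx Ac *m y) (invmx Ah *m y) (spd_spsd Ac0).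
have -> : bform Ac (invmx Ac *m y) (invmx Ah *m y) = qform (invmx Ah) y.
  rewrite bform_mull trmx_inv Act mulVmx // bform_mulr mul1mx.
  by rewrite /qform.
have := D0.2 (invmx Ah *m y); rewrite qformD qformN [qform Ah _]qform_congr.
rewrite trmx_inv Aht mulVmx // mul1mx.
rewrite [qform Ac (invmx Ac *m y)]qform_congr trmx_inv Act mulVmx // mul1mx.
have := (spd_spsd (spd_inv Ah0)).2 y; have := (spd_spsd (spd_inv Ac0)).2 y.
have := (spd_spsd Ac0).2 (invmx Ah *m y).
move: (qform Ac (invmx Ah *m y)) (qform (invmx Ac) y) (qform (invmx Ah) y).
move=> a b c a0 b0 c0 ac h; rewrite mul1r lerBlDr lerDl c0 andbT subr_ge0.
have [->//|cN0] := eqVneq c 0.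
have cp : 0 < c by rewrite lt_def cN0.
rewrite -(ler_pM2l cp) -expr2 mulrC; apply: le_trans h _.
by rewrite ler_wpM2l //; lra.
Qed.

(** The error [E ^+ g *m invmx Ac] is the congruence of [Ac *m E ^+ g] by
    [invmx Ac]. *)
Lemma coarse_error_iterated p (Ac E : 'M[R]_p) g s :
  spd Ac -> spsd (Ac *m E) -> 0 <= s ->
  (forall v, qform (Ac *m E) v <= s * qform Ac v) ->
  coarse_error_le Ac ((1%:M - E ^+ g) *m invmx Ac) (s ^+ g).
Proof.
move=> Ac0 E0 s0 Es; have [Act _] := Ac0; have Acu := spd_unit Ac0.
have Eg0 := spsd_mul_exp g Ac0 E0; have Egs := qform_exp_le g Ac0 E0 s0 Es.
have -> : (1%:M - E ^+ g) *m invmx Ac =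
    invmx Ac - (invmx Ac)^T *m (Ac *m E ^+ g) *m invmx Ac.
  by rewrite trmx_inv Act mulKmx // mulmxBl mul1mx.
split=> [|y].
  rewrite linearB; congr (_ - _); first exact: (spd_inv Ac0).1.
  exact: (spsd_congr (invmx Ac) Eg0).1.
rewrite qformD qformN opprD opprK addrA subrr add0r -qform_congr Eg0.2 /=.
by apply: le_trans (Egs _) _; rewrite qform_congr trmx_inv Act mulVmx // mul1mx.
Qed.

End CoarseSolvers.

(** * One cycle with an approximate coarse solver *)

Section Cycle.
Variables (R : realType) (m p : nat) (A M : 'M[R]_m) (P : 'M[R]_(m, p)).
Variable Ac : 'M[R]_p.
Hypotheses (m_gt0 : (0 < m)%N) (A_spd : spd A) (M_unit : M \in unitmx).
Hypotheses (S_spd : spd (M + M^T - A)) (Ac_spd : spd Ac).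
Hypothesis AcE : Ac = P^T *m A *m P.

Let N := 1%:M - invmx M *m A.
Let cyc (B : 'M[R]_p) :=
  (1%:M - (invmx M)^T *m A) *m (1%:M - P *m B *m P^T *m A) *m N.
Let eps := lambda_min (invmx (M^T *m invmx (M + M^T - A) *m M) *m A).

Let mul_cycE B : A *m cyc B =
  N^T *m (A - (P^T *m A)^T *m B *m (P^T *m A)) *m N.
Proof.
rewrite /cyc !mulmxA smoother_adjoint // -(mulmxA N^T A); congr (_ *m _ *m _).
by rewrite mulmxBr mulmx1 trmx_mul trmxK A_spd.1 !mulmxA.
Qed.

Let qform_cyc B v : qform (A *m cyc B) v =
  qform A (N *m v) - qform B (P^T *m A *m (N *m v)).
Proof.
by rewrite mul_cycE -qform_congr qformD qformN -qform_congr.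
Qed.

(* The two-grid form is the squared energy norm of [w - P c], the part of [w]
   orthogonal to the range of [P]. *)
Let exact_ge0 v : 0 <= qform (A *m cyc (invmx Ac)) v.
Proof.
rewrite qform_cyc; set w := N *m v; set c := invmx Ac *m (P^T *m A *m w).
have := (spd_spsd A_spd).2 (w - P *m c).
rewrite qformE !bformDl !bformDr !bformNl !bformNr opprK.
have e1 : bform A (P *m c) w = qform (invmx Ac) (P^T *m A *m w).
  rewrite /bform /c !trmx_mul trmx_inv Ac_spd.1 /qform !trmx_mul !trmxK.
  by rewrite !mulmxA.
have e2 : bform A (P *m c) (P *m c) = qform (invmx Ac) (P^T *m A *m w).
  rewrite -qformE qform_congr -AcE /c [qform Ac _]qform_congr trmx_inv Ac_spd.1.
  by rewrite mulVmx ?mul1mx // spd_unit.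
rewrite (bform_sym w _ A_spd.1) e1 e2 -qformE.
by move=> h; apply: le_trans h _; rewrite le_eqVlt; apply/orP; left; apply/eqP; ring.
Qed.

(** Going from the exact coarse solver to [B] adds to the form the coarse error,
    which is at most [t] times the energy of the projection of [N v] onto the
    range of [P]; that energy is the one of [N v] minus the two-grid form. *)
Lemma cycle_bounds B t : 0 <= t -> coarse_error_le Ac B t ->
  [/\ spsd (A *m cyc B),
      forall v, qform (A *m cyc (invmx Ac)) v <= qform (A *m cyc B) v &
      forall v, qform (A *m cyc B) v <=
        (1 - t) * qform (A *m cyc (invmx Ac)) v + t * ((1 - eps) * qform A v)].
Proof.
move=> t0 [Bt Bb].
have lo v : qform (A *m cyc (invmx Ac)) v <= qform (A *m cyc B) v.
  have := Bb (P^T *m A *m (N *m v)); rewrite !qform_cyc => /andP[].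
  by rewrite subr_ge0 lerD2l lerN2.
split=> // [|v].
  split=> [|v]; last exact: le_trans (exact_ge0 v) (lo v).
  rewrite mul_cycE; move: (P^T *m A) => K; set X := A - _.
  have Xt : X^T = X.
    rewrite /X linearB /=; congr (_ - _); first exact: A_spd.1.
    by rewrite !trmx_mul trmxK Bt mulmxA.
  by rewrite !trmx_mul trmxK Xt mulmxA.
have := smoother_bound m_gt0 A_spd M_unit S_spd v.
have := Bb (P^T *m A *m (N *m v)) => /andP[]; rewrite !qform_cyc -/N -/eps.
move: (qform (invmx Ac) _) (qform B _) (qform A (N *m v)) => a b c h1 h2 h3.
nra.
Qed.
End Cycle.

(** * The scalar recursion *)

Section Scalar.
Variable R : realType.

Lemma root_fixpoint (sigma eps : R) g : (0 < g)%N ->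
  0 < sigma -> 0 < eps -> sigma < 1 - eps ->
  exists x : R,
    [/\ [/\ 0 < x, x < 1 & (1 - sigma - eps) * x ^+ g - x + sigma = 0],
      (forall y, [/\ 0 < y, y < 1 & (1 - sigma - eps) * y ^+ g - y + sigma = 0] -> y = x) &
      sigma < x <= sigma / (sigma + eps)].
Proof.
move=> g0 s0 e0 lt1; set c := 1 - sigma - eps.
have c0 : 0 < c by rewrite /c; lra.
have se0 : 0 < sigma + eps by lra.
set y1 := sigma / (sigma + eps).
have y1lt : y1 < 1 by rewrite /y1 ltr_pdivrMr // mul1r; lra.
have y1gt : sigma < y1 by rewrite /y1 ltr_pdivlMr //; nra.
have y1p : 0 < y1 by lra.
have uniq x y : [/\ 0 < x, x < 1 & c * x ^+ g - x + sigma = 0] ->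
    [/\ 0 < y, y < 1 & c * y ^+ g - y + sigma = 0] -> ~ x < y.
  (* the map [t |-> c * t ^+ g + sigma] is convex and lies below the diagonal
     at [1]: its chord slope is [1] on [x, y] and less than [1] on [y, 1] *)
  move=> [x0 x1 xr] [y0 y2 yr] xy.
  have h1 : c * \sum_(i < g) y ^+ (g.-1 - i) * x ^+ i = 1.
    have := subrXX y x g; set h := \sum_(i < g) _ => e.
    have yx : y - x != 0 by rewrite subr_eq0 gt_eqF.
    apply: (mulfI yx); rewrite mulr1 mulrCA -e; nra.
  have h2 : c * \sum_(i < g) 1 ^+ (g.-1 - i) * y ^+ i < 1.
    have := subrXX 1 y g; rewrite expr1n; set h := \sum_(i < g) _ => e.
    have yx : 0 < 1 - y by rewrite subr_gt0.
    rewrite -(ltr_pM2l yx) mulr1 mulrCA -e /c; rewrite /c in yr; nra.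
  move: h2; apply/negP; rewrite -leNgt -[leLHS]h1 ler_pM2l //.
  apply: ler_sum => i _; apply: ler_pM; [by rewrite exprn_ge0 ?ltW| by rewrite exprn_ge0 ?ltW| |].
    by rewrite expr1n exprn_ile1 // ltW.
  by rewrite lerXn2r ?nnegrE // ltW.
(* the sign is chosen so that [p] goes from nonpositive to nonnegative *)
pose p : {poly R} := 'X - c *: 'X^g - sigma%:P.
have pE z : p.[z] = - (c * z ^+ g - z + sigma) by rewrite /p !hornerE; ring.
have y1g : y1 ^+ g <= y1.
  by case: g g0 {uniq p pE} => // g _; rewrite exprS ler_piMr ?exprn_ile1 // ltW.
have := @poly_ivt R p sigma y1 (ltW y1gt).
have -> : p.[sigma] <= 0 <= p.[y1].
  rewrite !pE !oppr_le0 oppr_ge0 subrK mulr_ge0 ?exprn_ge0 ?(ltW s0) ?(ltW c0) //=.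
  have e : sigma = y1 * (sigma + eps) by rewrite /y1 mulfVK // gt_eqF.
  have : c * y1 ^+ g <= c * y1 by rewrite ler_pM2l.
  have : c * y1 = y1 - sigma by rewrite /c; move: e; lra.
  lra.
move=> /(_ isT) [x /andP[x1 x2]]; rewrite rootE pE oppr_eq0 => /eqP xr.
have x0 : 0 < x by lra.
have xlt : sigma < x.
  have : 0 < c * x ^+ g by rewrite mulr_gt0 ?exprn_gt0.
  lra.
have xroot : [/\ 0 < x, x < 1 & c * x ^+ g - x + sigma = 0] by split=> //; lra.
exists x; split=> [//|y yr|]; last by rewrite xlt.
by case: (ltgtP y x) => // /(uniq _ _); case.
Qed.

(** [x - s'] is at least [c * (x ^+ g - s ^+ g)], and the cofactor of [x - s] in
    [x ^+ g - s ^+ g] is increasing in [s], hence smallest at [d]. *)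
Lemma fixpoint_error_step (c sigma x s s' d : R) g : (0 < g)%N ->
  0 <= c -> 0 < x -> x = sigma + c * x ^+ g ->
  0 <= d <= s -> s <= x -> s' <= sigma + c * s ^+ g ->
  (x - s) * (c * x ^+ g.-1 * \sum_(0 <= j < g) (d / x) ^+ j) <= x - s'.
Proof.
move=> g0 c0 x0 xr /andP[d0 ds] sx s'le.
have -> : c * x ^+ g.-1 * \sum_(0 <= j < g) (d / x) ^+ j =
    c * \sum_(i < g) x ^+ (g.-1 - i) * d ^+ i.
  rewrite -mulrA; congr (_ * _); rewrite big_mkord mulr_sumr.
  apply: eq_bigr => i _.
  have ig : (i <= g.-1)%N by rewrite -ltnS prednK.
  rewrite -{1}(subnK ig) exprD expr_div_n -mulrA; congr (_ * _).
  by rewrite mulrC mulfVK // expf_neq0 // gt_eqF.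
apply: le_trans (_ : c * (x ^+ g - s ^+ g) <= _); last by rewrite mulrBr; lra.
rewrite subrXX mulrCA ler_wpM2l // ler_wpM2l ?subr_ge0 //.
apply: ler_sum => i _; rewrite ler_wpM2l ?exprn_ge0 ?(ltW x0) //.
by rewrite lerXn2r ?nnegrE // (le_trans d0).
Qed.

Lemma fixpoint_error_bound (c sigma x d : R) (s : nat -> R) g L : (0 < g)%N ->
  0 <= c -> 0 < x -> x = sigma + c * x ^+ g -> 0 <= d ->
  (forall k, (1 <= k)%N -> (k < L)%N -> s k <= x ->
     d <= s k /\ s k.+1 <= sigma + c * s k ^+ g) ->
  s 1%N < x -> forall k, (1 <= k <= L)%N ->
  s k <= x - (x - s 1%N) *
    (c * x ^+ g.-1 * \sum_(0 <= j < g) (d / x) ^+ j) ^+ k.-1.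
Proof.
move=> g0 c0 x0 xr d0 step s1x.
set q := c * _ * _.
have q0 : 0 <= q.
  rewrite /q !mulr_ge0 ?exprn_ge0 ?(ltW x0) //; apply: sumr_ge0 => j _.
  by rewrite exprn_ge0 // divr_ge0 // ltW.
suff H k : (k < L)%N -> (x - s 1%N) * q ^+ k <= x - s k.+1.
  by case=> // k /H /=; lra.
elim: k => [_|k IH kL]; first by rewrite expr0 mulr1.
have {}IH := IH (ltnW kL).
have sx : s k.+1 <= x.
  rewrite -subr_ge0; apply: le_trans IH.
  by rewrite mulr_ge0 ?exprn_ge0 // subr_ge0 ltW.
have [ds sle] := step k.+1 isT kL sx.
rewrite exprSr mulrA; apply: le_trans (ler_wpM2r q0 IH) _.
by apply: (fixpoint_error_step g0 c0 x0 xr _ sx sle); rewrite d0.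
Qed.

End Scalar.

(** * Extrema over the levels *)

Section Levels.
Variable R : realType.

Lemma level_max_ge L (f : nat -> R) k : (1 <= k <= L)%N -> f k <= level_max L f.
Proof. by move=> kL; apply: le_bigmax_seq => //; rewrite mem_index_iota. Qed.

Lemma level_min_le L (f : nat -> R) k : (1 <= k <= L)%N -> level_min L f <= f k.
Proof. by move=> kL; apply: ge_bigmin_seq => //; rewrite mem_index_iota. Qed.

Lemma level_min_ind (K : R -> Prop) L (f : nat -> R) : (0 < L)%N ->
  (forall k, (1 <= k <= L)%N -> K (f k)) -> K (level_min L f).
Proof.
move=> L0 Kf; rewrite /level_min big_seq.
apply: (big_ind K) => [|x y Kx Ky|k]; first exact: Kf.
  by rewrite minEle; case: ifP.
by rewrite mem_index_iota => /Kf.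
Qed.

End Levels.

(** * The multigrid hierarchy *)

Section Hierarchy.
Variables (R : realType) (L gamma : nat) (n : nat -> nat).
Variables (A : forall k, 'M[R]_(n k)) (P : forall k, 'M[R]_(n k, n k.-1)).
Variables (M : forall k, 'M[R]_(n k)) (Ahat0 : 'M[R]_(n 0%N)).
Hypothesis n_incr : forall k, (1 <= k <= L)%N -> (n k.-1 < n k)%N.
Hypothesis A_spd : spd (A L).
Hypothesis P_rank : forall k, (1 <= k <= L)%N -> \rank (P k) = n k.-1.
Hypothesis A_galerkin : forall k, (1 <= k <= L)%N ->
  A k.-1 = (P k)^T *m A k *m P k.
Hypotheses (Ahat0_spd : spd Ahat0) (Ahat0_ge : spsd (Ahat0 - A 0%N)).
Hypothesis M_unit : forall k, (1 <= k <= L)%N -> M k \in unitmx.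
Hypothesis M_spd : forall k, (1 <= k <= L)%N -> spd (M k + (M k)^T - A k).

Let sTG := sigma_TG A P M.
Let sIMG := sigma_IMG A P M Ahat0 gamma.
Let EIMG := E_IMG A P M Ahat0 gamma.
Let ETG := E_TG A P M.
Let eps k := lambda_min (invmx (Mtilde A M k) *m A k).

Lemma galerkin_spd k : (k <= L)%N -> spd (A k).
Proof.
move=> kL; rewrite -(subKn kL); elim: (L - k)%N => [|d IH]; first by rewrite subn0.
have [dL|dL] := ltnP d L; last first.
  suff -> : (L - d.+1 = L - d)%N by [].
  by move: dL (leqW dL); rewrite -!subn_eq0 => /eqP -> /eqP ->.
have e : (L - d = (L - d.+1).+1)%N by rewrite -subSS subSn.
rewrite e in IH.
have kb : (1 <= (L - d.+1).+1 <= L)%N by rewrite -e subn_gt0 dL leq_subr.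
rewrite -[X in A X]/((L - d.+1).+1.-1) A_galerkin //.
by apply: spd_congr => //; apply: mxrank_inj; apply: P_rank.
Qed.

Let n_gt0 k : (1 <= k <= L)%N -> (0 < n k)%N.
Proof. by move=> /n_incr; apply: leq_ltn_trans. Qed.

Lemma eps_gt0 k : (1 <= k <= L)%N -> 0 < eps k.
Proof.
move=> kL; have /andP[_ kL'] := kL.
by apply: smoother_eps_gt0; [exact: n_gt0|exact: galerkin_spd|exact: M_unit|exact: M_spd].
Qed.

Lemma cycle_level k B t : (1 <= k <= L)%N -> 0 <= t -> coarse_error_le (A k.-1) B t ->
  [/\ spsd (A k *m cycle_mx A P M (k:=k) B),
      forall v, qform (A k *m ETG k) v <= qform (A k *m cycle_mx A P M (k:=k) B) v &
      forall v, qform (A k *m cycle_mx A P M (k:=k) B) v <=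
        (1 - t) * qform (A k *m ETG k) v + t * ((1 - eps k) * qform (A k) v)].
Proof.
move=> kL; have /andP[_ kL'] := kL.
apply: cycle_bounds; [exact: n_gt0|exact: galerkin_spd|exact: M_unit|exact: M_spd| |].
  by apply: galerkin_spd; apply: leq_trans (leq_pred k) kL'.
exact: A_galerkin.
Qed.

(* The exact solver is regarded as having relative error at most [1]: the upper
   bound of [cycle_level] then no longer involves the two-grid form itself. *)
Let TG_bounds k : (1 <= k <= L)%N ->
  spsd (A k *m ETG k) /\ forall v, qform (A k *m ETG k) v <= qform (A k) v.
Proof.
move=> kL; have kL' : (k.-1 <= L)%N.
  by case/andP: kL => _; apply: leq_trans (leq_pred k).
have Ac0 := galerkin_spd kL'.
have ex0 := coarse_error_exact Ac0.
have ex1 : coarse_error_le (A k.-1) (invmx (A k.-1)) 1.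
  split=> [|y]; first exact: ex0.1.
  by rewrite subrr lexx mul1r (spd_spsd (spd_inv Ac0)).2.
have [h0 _ h1] := cycle_level kL ler01 ex1.
split=> // v; apply: le_trans (h1 v) _.
rewrite subrr mul0r add0r mul1r; have := eps_gt0 kL.
have [_ kL''] := andP kL; have := (spd_spsd (galerkin_spd kL'')).2 v; nra.
Qed.

Let IMG_step k B t : (1 <= k <= L)%N -> 0 <= t <= 1 ->
  coarse_error_le (A k.-1) B t ->
  let E := cycle_mx A P M (k:=k) B in
  [/\ spsd (A k *m E),
      forall v, qform (A k *m ETG k) v <= qform (A k *m E) v,
      forall v, qform (A k *m E) v <= qform (A k) v &
      mxnorm (A k) E <= (1 - t) * sTG k + t * (1 - eps k)].
Proof.
move=> kL /andP[t0 t1] Bt E; have [_ kL'] := andP kL.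
have [E0 lo hi] := cycle_level kL t0 Bt.
have [TG0 TG1] := TG_bounds kL.
have Ak0 := galerkin_spd kL'; have q0 := (spd_spsd Ak0).2.
have e0 := eps_gt0 kL.
have E1 v : qform (A k *m E) v <= qform (A k) v.
  apply: le_trans (hi v) _; have := TG1 v; have := q0 v.
  move: (qform (A k) v) (qform (A k *m ETG k) v) => a b a0 ba.
  have h1 : (1 - t) * b <= (1 - t) * a by rewrite ler_wpM2l // subr_ge0.
  have h2 : 0 <= t * (eps k * a) by rewrite !mulr_ge0 // ltW.
  have h3 : t * ((1 - eps k) * a) = t * a - t * (eps k * a) by ring.
  lra.
split=> //.
have bound v : qform (A k *m E) v <= ((1 - t) * sTG k + t * (1 - eps k)) * qform (A k) v.
  apply: le_trans (hi v) _.
  have t1' : 0 <= 1 - t by rewrite subr_ge0.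
  have := ler_wpM2l t1' (mxnorm_qform (n_gt0 kL) Ak0 TG0 TG1 v).
  by rewrite -[mxnorm _ _]/(sTG k); lra.
apply: (mxnorm_le (n_gt0 kL) Ak0 E0 _ bound).
(* a bound on a nonnegative form is nonnegative, since level [k] has a nonzero
   vector *)
have [v v0] := nonzero_cV R (n_gt0 kL).
have := le_trans (E0.2 v) (bound v).
by rewrite pmulr_lge0 // Ak0.2.
Qed.

(** The crude bound [1] at each level needs only the same bound one level below;
    it makes the norms meaningful before they are estimated. *)
Lemma IMG_bounds k : (1 <= k <= L)%N ->
  [/\ spsd (A k *m EIMG k),
      forall v, qform (A k *m ETG k) v <= qform (A k *m EIMG k) v &
      forall v, qform (A k *m EIMG k) v <= qform (A k) v].
Proof.
elim: k => [//|[|j] IH] kL.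
  have ch : coarse_error_le (A 0%N) (invmx Ahat0) 1.
    by apply: coarse_error_dominating => //; apply: galerkin_spd.
  by have [] := IMG_step kL (introT andP (conj ler01 (lexx _))) ch.
have jL : (1 <= j.+1 <= L)%N by case/andP: kL => _ /ltnW.
have [E0 _ E1] := IH jL.
have Ac0 : spd (A j.+1) by apply: galerkin_spd; case/andP: jL.
have E1' v : qform (A j.+1 *m EIMG j.+1) v <= 1 * qform (A j.+1) v.
  by rewrite mul1r.
have := coarse_error_iterated gamma Ac0 E0 ler01 E1'; rewrite expr1n => ch.
by have [] := IMG_step kL (introT andP (conj ler01 (lexx _))) ch.
Qed.

Lemma sigma_TG_le_IMG k : (1 <= k <= L)%N -> 0 <= sTG k <= sIMG k.
Proof.
move=> kL; have [_ kL'] := andP kL; have n0 := n_gt0 kL.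
have Ak0 := galerkin_spd kL'.
have [E0 lo E1] := IMG_bounds kL; have [TG0 TG1] := TG_bounds kL.
apply/andP; split; first exact: mxnorm_ge0 n0 Ak0 TG0 TG1.
apply: (mxnorm_le n0 Ak0 TG0 (mxnorm_ge0 n0 Ak0 E0 E1)) => v.
exact: le_trans (lo v) (mxnorm_qform n0 Ak0 E0 E1 v).
Qed.

Lemma sigma_IMG_step k : (1 <= k)%N -> (k < L)%N -> sIMG k <= 1 ->
  sIMG k.+1 <= (1 - sIMG k ^+ gamma) * sTG k.+1 + sIMG k ^+ gamma * (1 - eps k.+1).
Proof.
case: k => // j _ kL s1.
have jL : (1 <= j.+1 <= L)%N := ltnW kL.
have Ac0 : spd (A j.+1) by apply: galerkin_spd; case/andP: jL.
have n0 := n_gt0 jL; have [E0 lo E1] := IMG_bounds jL.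
have s0 : 0 <= sIMG j.+1 := mxnorm_ge0 n0 Ac0 E0 E1.
have ch := coarse_error_iterated gamma Ac0 E0 s0 (mxnorm_qform n0 Ac0 E0 E1).
have t01 : 0 <= sIMG j.+1 ^+ gamma <= 1 by rewrite exprn_ge0 //= exprn_ile1.
by have [] := IMG_step (k := j.+2) kL t01 ch.
Qed.

End Hierarchy.

Unset Implicit Arguments.
Set Strict Implicit.

Theorem theorem4p7 (R : realType) (L gamma : nat) (n : nat -> nat)
    (A : forall k, 'M[R]_(n k)) (P : forall k, 'M[R]_(n k, n k.-1))
    (M : forall k, 'M[R]_(n k)) (Ahat0 : 'M[R]_(n 0%N))
    (L_gt0 : (0 < L)%N) (gamma_gt0 : (0 < gamma)%N)
    (n_incr : forall k, (1 <= k <= L)%N -> (n k.-1 < n k)%N)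
    (A_spd : spd (A L))
    (P_rank : forall k, (1 <= k <= L)%N -> \rank (P k) = n k.-1)
    (A_galerkin : forall k, (1 <= k <= L)%N ->
       A k.-1 = (P k)^T *m A k *m P k)
    (Ahat0_spd : spd Ahat0) (Ahat0_ge : spsd (Ahat0 - A 0%N))
    (M_unit : forall k, (1 <= k <= L)%N -> M k \in unitmx)
    (M_spd : forall k, (1 <= k <= L)%N -> spd (M k + (M k)^T - A k)) :
  let sTG := sigma_TG A P M in
  let sIMG := sigma_IMG A P M Ahat0 gamma in
  let sigma := level_max L sTG in
  let eps := level_min L (fun k => lambda_min (invmx (Mtilde A M k) *m A k)) in
  let delta := level_min L sTG in
  let is_root x :=
    [/\ 0 < x, x < 1 & (1 - sigma - eps) * x ^+ gamma - x + sigma = 0] in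
  0 < sigma -> sigma < 1 - eps ->
  exists x : R,
    [/\ is_root x, (forall y, is_root y -> y = x),
        sigma < x <= sigma / (sigma + eps) &
        sIMG 1%N < x ->
        forall k, (1 <= k <= L)%N ->
          sIMG k <= x - (x - sIMG 1%N) *
            ((1 - sigma - eps) * x ^+ gamma.-1 *
             \sum_(0 <= j < gamma) (delta / x) ^+ j) ^+ k.-1].
Proof.
move=> sTG sIMG sigma eps delta is_root sigma_gt0 sigma_lt.
have eps_gt0 : 0 < eps.
  apply: (level_min_ind (K := fun e => 0 < e)) => //.
  by apply: eps_gt0 P_rank A_galerkin M_unit M_spd.
have [x [xr xuniq xb]] := root_fixpoint gamma_gt0 sigma_gt0 eps_gt0 sigma_lt.
exists x; split=> // s1x; have [x0 x1 xeq] := xr.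
set c := 1 - sigma - eps in xeq *.
have c0 : 0 <= c by rewrite /c; lra.
have d0 : 0 <= delta.
  apply: (level_min_ind (K := fun d => 0 <= d)) => // k kL.
  by have /andP[] := sigma_TG_le_IMG gamma n_incr A_spd P_rank
    A_galerkin Ahat0_spd Ahat0_ge M_unit M_spd kL.
have xfix : x = sigma + c * x ^+ gamma by move: xeq; lra.
apply: (fixpoint_error_bound (s := sIMG) gamma_gt0 c0 x0 xfix d0 _ s1x).
move=> k k1 kL sx; have kb : (1 <= k <= L)%N by rewrite k1 ltnW.
have /andP[TG0 TGI] := sigma_TG_le_IMG gamma n_incr A_spd P_rank
  A_galerkin Ahat0_spd Ahat0_ge M_unit M_spd kb.
have s0 : 0 <= sIMG k := le_trans TG0 TGI.
split; first exact: le_trans (level_min_le sTG kb) TGI.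
have sk1 : sIMG k <= 1 := le_trans sx (ltW x1).
have kb' : (1 <= k.+1 <= L)%N by [].
apply: le_trans (sigma_IMG_step n_incr A_spd P_rank A_galerkin
  Ahat0_spd Ahat0_ge M_unit M_spd k1 kL sk1) _.
have := level_min_le (fun k => lambda_min (invmx (Mtilde A M k) *m A k)) kb'.
have := level_max_ge sTG kb'.
have := exprn_ge0 gamma s0; have := exprn_ile1 gamma s0 sk1.
rewrite -/sigma -/eps -/sIMG -/sTG /c.
clear -R; move: (sIMG k ^+ gamma) (sTG k.+1) (lambda_min _) sigma eps.
move=> t a e sigma' eps' t1 t0 a_le e_ge.
have h1 : (1 - t) * a <= (1 - t) * sigma' by rewrite ler_wpM2l // subr_ge0.
have h2 := ler_wpM2l t0 e_ge.
lra.
Qed.
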